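(* Let $\{\mu_n\}_{n>0}$ be a sequence of probability measures on $\mathbb{R}$, each with mean $0$ and variance $1$, and each infinitely divisible with respect to classical convolution $*$. Let $X_n$ be a random variable with distribution $\mu_n$. If $E[X_n^4]=\int_{\mathbb{R}}x^4\,\mu_n(dx)\to 3$ as $n\to\infty$, then $\mu_n$ converges weakly to the standard normal distribution $\mathcal{N}(0,1)$.
   Context: A probability measure $\mu$ on $\mathbb{R}$ is infinitely divisible with respect to classical convolution, written $\mu\in ID( * )$, if for every $N\in\mathbb{N}$ there is a probability measure $\nu_N$ on $\mathbb{R}$ with $\mu=\nu_N^{*N}$ ($N$-fold classical convolution power). *)

(* Defs.v *)
From HB Require Import structures.
From mathcomp Require Import all_boot all_order all_algebra.
From mathcomp Require Import all_classical all_reals all_analysis.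
From mathcomp Require Import measurable_realfun.

Set Implicit Arguments.
Unset Strict Implicit.
Unset Printing Implicit Defensive.

Import Order.TTheory GRing.Theory Num.Theory.
Import numFieldNormedType.Exports.

Local Open Scope classical_set_scope.
Local Open Scope ring_scope.

Notation probR R := (probability (measurableTypeR R) R).

Section convolution.
Context {R : realType}.

Definition add_pair (x : measurableTypeR R * measurableTypeR R) :
  measurableTypeR R := x.1 + x.2.

Lemma measurable_add_pair : measurable_fun [set: _] add_pair.
Proof. by apply: measurable_funD. Qed.

HB.instance Definition _ :=
  @isMeasurableFun.Build _ _ _ _ add_pair measurable_add_pair.

Definition convolution (mu nu : probR R) : probR R :=
  distribution (mu \x nu)%E add_pair.

(* The empty convolution power is the unit of the convolution. *)
Fixpoint convolution_power (nu : probR R) (N : nat) : probR R :=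
  if N is N'.+1 then convolution (convolution_power nu N') nu
  else dirac (0 : measurableTypeR R).

(* Measures are compared on Borel sets only: the underlying set functions are
   also defined, but unconstrained, on the other sets. *)
Definition infinitely_divisible (mu : probR R) : Prop :=
  forall N : nat, (0 < N)%N -> exists nu : probR R,
    forall A : set (measurableTypeR R), measurable A ->
      mu A = convolution_power nu N A.

End convolution.

Definition cvg_weakly {R : realType} (mu : nat -> probR R) (nu : probR R) :
    Prop :=
  forall f : R -> R, continuous f -> bounded_fun f ->
    (\int[mu n]_x (f x)%:E)%E @[n --> \oo] --> (\int[nu]_x (f x)%:E)%E.

(* Main.v *)
Require Import Defs.
From HB Require Import structures.
From mathcomp Require Import all_boot all_order all_algebra.
From mathcomp Require Import all_classical all_reals all_analysis.
From mathcomp Require Import measurable_realfun ring lra.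

(**
The proof is Stein's method, applied to the summands that infinite
divisibility provides.

Let [c] be the integral of a bounded continuous [f] under N(0,1).  The Stein
equation [g' x - x * g x = f x - c] has a solution [g] with [g'] continuous and
bounded ([stein_solution]).  Integrated against a centred law of variance 1, it turns
the difference between [c] and the mean of [f] into the defect
[E (X * g X) - Var X * E (g' X)] in Stein's identity; the task is to
show that the defect of [mu n] tends to 0.

The defect is additive: conditioning on one of two independent centred
summands, the defect of a sum splits into the defects of the summands, each for
a translate of [g] ([stein_defect_convolution]).  The defects are therefore
bounded for all translates by [z] at once, in the form [A + B * z ^+ 2], and the
quadratic weight integrates to a variance.  A law of variance 1 that is an
[N]-fold convolution power of [nu] thus has at most [N] times the defect of
[nu], up to the weights ([stein_defect_power]).

For a single summand [Y], Taylor expansion gives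
[Y * g (z + Y) = Y * g z + Y ^+ 2 * g' z + remainder], where the first two terms
have the expected integrals.  Because [g'] is bounded and continuous, for every
[e] there is a constant [D] such that its increments satisfy
[`|g' (s + y) - g' s| <= e * (1 + s ^+ 2) + D * y ^+ 2]
([bounded_continuous_modulus]).  So the defect of [Y] is controlled by
[e * E (Y ^+ 2)] and [D * E (Y ^+ 4)] ([stein_defect_single]).

Summing [N] such bounds leaves [4 * e + D * (N * E (Y ^+ 4) + 1 / N)].  The
fourth moment of a sum of [N] centred independent copies of [Y] with total
variance 1 is [N * E (Y ^+ 4) + 3 * (1 - 1 / N)] ([moment4_power]); hence
[N * E (Y ^+ 4)] is the fourth moment of [mu] minus 3, plus [3 / N].  As [N] is
arbitrary, the defect of an infinitely divisible [mu] is at most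
[4 * e + D * (E (X ^+ 4) - 3)] ([stein_defect_infinitely_divisible]), which
tends to [4 * e] along the sequence.
*)

Set Implicit Arguments.
Unset Strict Implicit.
Unset Printing Implicit Defensive.

Import Order.TTheory GRing.Theory Num.Theory.
Import numFieldNormedType.Exports.

Local Open Scope classical_set_scope.
Local Open Scope ring_scope.

(** * The standard normal density and its tails *)

Section normal_density.
Context {R : realType}.
Local Notation leb := (@lebesgue_measure R).
Local Notation phi := (@normal_pdf R 0 1).

(** The density is the Radon-Nikodym derivative of the normal law up to a null
set, because both have the same integral over every measurable set. *)
Lemma integral_normal_prob (m s : R) (f : R -> \bar R) :
  (normal_prob m s).-integrable setT f ->
  (\int[normal_prob m s]_x f x = \int[leb]_x (f x * (normal_pdf m s x)%:E))%E.
Proof.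
move=> intf; have mf := measurable_int _ intf.
rewrite -(Radon_Nikodym_change_of_variables (normal_prob_dominates m s))//=.
have mpdf : measurable_fun setT (fun x => (normal_pdf m s x)%:E).
  by apply/measurable_EFinP; exact: measurable_normal_pdf.
apply: ae_eq_integral => //.
- apply: emeasurable_funM => //; apply: (measurable_int leb).
  by apply: Radon_Nikodym_integrable; exact: normal_prob_dominates.
- exact: emeasurable_funM.
- apply: ae_eqe_mul2l => /=.
  rewrite Radon_NikodymE//=; first exact: normal_prob_dominates.
  move=> ?; case: cid => /= h [h1 h2 h3].
  by apply: integral_ae_eq => //= E _ mE; rewrite -h3.
Qed.

Lemma normal_pdf01E (x : R) :
  phi x = normal_peak (1 : R) * expR (- (2^-1 * x ^+ 2)).
Proof.
rewrite normal_pdfE ?oner_neq0// /normal_fun subr0 expr1n; congr (_ * expR _).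
by rewrite mulNr mulrC.
Qed.

Lemma normal_pdf01_gt0 (x : R) : 0 < phi x.
Proof.
by rewrite normal_pdf01E mulr_gt0 ?expR_gt0// normal_peak_gt0 ?oner_neq0.
Qed.

Lemma normal_pdf01N (x : R) : phi (- x) = phi x.
Proof. by rewrite !normal_pdf01E sqrrN. Qed.

Lemma continuous_normal_pdf01 : continuous phi.
Proof. exact: continuous_normal_pdf (oner_neq0 R). Qed.

Lemma is_derive_normal_pdf01 (x : R) : is_derive x 1 phi (- x * phi x).
Proof.
rewrite (_ : phi = fun y => normal_peak (1 : R) * expR (- (2^-1 * y ^+ 2))).
  by apply: is_derive_eq; rewrite /GRing.scale/=; field.
by apply/funext => y; rewrite normal_pdf01E.
Qed.

Lemma cvgy_normal_pdf01 : phi x @[x --> +oo] --> 0.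
Proof.
rewrite (_ : phi = fun y => normal_peak (1 : R) * expR (- (2^-1 * y ^+ 2))).
  rewrite -[X in _ --> X](mulr0 (normal_peak (1 : R))).
  apply: cvgMr.
  apply: (cvg_comp (fun x => 2^-1 * x ^+ 2) (fun x => expR (- x))).
    apply: gt0_cvgMry; first by rewrite invr_gt0.
    exact: cvgr_expr2.
  exact: cvgr_expR.
by apply/funext => y; rewrite normal_pdf01E.
Qed.

(** The integrand is exactly the derivative of the opposite of the density. *)
Lemma integral_id_normal_pdf01 (a : R) : 0 <= a ->
  (\int[leb]_(t in `[a, +oo[) (t * phi t)%:E = (phi a)%:E)%E.
Proof.
move=> a0.
have dN (x : R) : is_derive x 1 (fun y => - phi y) (x * phi x).
  by have ? := is_derive_normal_pdf01 x; apply: is_derive_eq; rewrite mulNr opprK.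
rewrite (@ge0_continuous_FTC2y _ _ (fun x => - phi x) _ 0).
- by rewrite EFinN oppeK add0e.
- move=> x ax; rewrite mulr_ge0 ?(le_trans a0 ax)//; exact: normal_pdf_ge0.
- apply: continuous_subspaceT => x.
  by apply: cvgM; [exact: cvg_id|exact: continuous_normal_pdf01].
- rewrite -[X in _ --> X]oppr0; apply: cvgN; exact: cvgy_normal_pdf01.
- by move=> x _; apply: ex_derive.
- apply: cvg_at_right_filter; apply: cvgN.
  exact: continuous_normal_pdf01.
- by move=> x _; rewrite derive1E derive_val.
Qed.

(** Mills' bound: on [`[a, +oo[] the constant [a] is at most the integration
variable, so the previous integral dominates. *)
Lemma mills_right (a : R) : 0 <= a ->
  (a%:E * \int[leb]_(t in `[a, +oo[) (phi t)%:E <= (phi a)%:E)%E.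
Proof.
move=> a0; have mphi := @measurable_normal_pdf R 0 1.
rewrite -integral_id_normal_pdf01// -ge0_integralZl//=.
- apply: ge0_le_integral => //=.
  + by move=> x _; rewrite lee_fin mulr_ge0// normal_pdf_ge0.
  + by apply/measurable_EFinP/measurable_funTS/measurable_funM.
  + by apply/measurable_EFinP/measurable_funTS/measurable_funM.
  + move=> x; rewrite in_itv/= andbT => ax; rewrite lee_fin ler_wpM2r//.
    exact: normal_pdf_ge0.
- by apply/measurable_EFinP/measurable_funTS.
- by move=> x _; rewrite lee_fin normal_pdf_ge0.
Qed.

Lemma mills_left (a : R) : 0 <= a ->
  (a%:E * \int[leb]_(t in `]-oo, (- a)%R]) (phi t)%:E <= (phi a)%:E)%E.
Proof.
move=> a0; rewrite ge0_integration_by_substitutionNy.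
- under eq_integral do rewrite /= normal_pdf01N; exact: mills_right.
- by apply: continuous_subspaceT => x; exact: continuous_normal_pdf01.
- by move=> x _; exact: normal_pdf_ge0.
Qed.

End normal_density.

(** * Increments of bounded continuous functions *)

Section real_functions.
Context {R : realType}.

(** Uniform continuity is guaranteed on compact sets only, but its failure
elsewhere can be absorbed: where [s] is large the term [e * s ^+ 2] exceeds the oscillation of
[h], and where [y] is not small the term [C * y ^+ 2] does. *)
Lemma bounded_continuous_modulus (h : R -> R) (B e : R) :
  continuous h -> (forall x, `|h x| <= B) -> 0 < e ->
  exists2 C, 0 <= C & forall s y,
    `|h (s + y) - h s| <= e * (1 + s ^+ 2) + C * y ^+ 2.
Proof.
move=> ch hB e0.
have B0 : 0 <= B by exact: le_trans (normr_ge0 _) (hB 0).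
have h2B s y : `|h (s + y) - h s| <= 2 * B.
  rewrite (le_trans (ler_normB _ _))//.
  by have := hB (s + y); have := hB s; lra.
(* Beyond [K], [e * s ^+ 2 >= e * K >= 2 * B]; the summand 1 ensures
   [K <= K ^+ 2]. *)
pose K := 1 + 2 * B / e.
have K1 : 1 <= K by rewrite lerDl divr_ge0 ?mulr_ge0// ltW.
have [d d0 dP] : exists2 d, 0 < d & forall s, `|s| <= K ->
    forall y, `|y| < d -> `|h (s + y) - h s| <= e.
  have /compact_near_coveringP cK := @segment_compact R (- K) K.
  have := cK R (0^'+) (fun d s => forall y, `|y| < d -> `|h (s + y) - h s| <= e) _.
  case.
    move=> x _.
    have [r r0 hr] : exists2 r : R, 0 < r &
        forall z : R, `|(x : R) - z| < r + r -> `|h x - h z| < e / 2.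
      have := ch x => /cvgrPdist_lt /(_ (e / 2)).
      rewrite divr_gt0// => /(_ isT) /nbhs_ballP[r /= r0 hr].
      exists (r / 2); first by rewrite divr_gt0.
      by move=> z xz; apply: hr; rewrite /ball/= -[ltRHS]splitr in xz *.
    near=> x' d => /= y yd.
    have xx' : `|(x : R) - x'| < r by near: x'; exact: cvgr_dist_lt.
    have dr : d < r by near: d; exact: nbhs_right_lt.
    have h1 : `|h x - h x'| < e / 2.
      by apply: hr; rewrite (lt_trans xx')// ltrDl.
    have h2 : `|h x - h (x' + y)| < e / 2.
      apply: hr; rewrite opprD addrA (le_lt_trans (ler_normB _ _))//.
      by rewrite ltrD// (lt_trans yd).
    rewrite (_ : _ - _ = (h x - h x') - (h x - h (x' + y))); last by ring.
    by rewrite (le_trans (ler_normB _ _))// [leRHS]splitr ltW// ltrD.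
  move=> r /= r0 hr; exists (r / 2); first by rewrite divr_gt0.
  move=> s sK y; apply: hr => //=; last by rewrite in_itv/= -ler_norml.
    by rewrite sub0r normrN gtr0_norm ?divr_gt0//; lra.
  by rewrite divr_gt0.
exists (2 * B / d ^+ 2); first by rewrite divr_ge0 ?mulr_ge0// ltW// exprn_gt0.
move=> s y.
have t1 : 0 <= e * (1 + s ^+ 2) by rewrite mulr_ge0 ?addr_ge0 ?sqr_ge0// ltW.
have t2 : 0 <= 2 * B / d ^+ 2 * y ^+ 2.
  by rewrite mulr_ge0 ?sqr_ge0// divr_ge0 ?mulr_ge0// ltW// exprn_gt0.
have [yd|yd] := ltP `|y| d; last first.
  apply: (le_trans (h2B s y)); apply: ler_wpDl => //.
  rewrite mulrAC ler_pdivlMr ?exprn_gt0// ler_wpM2l ?mulr_ge0//.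
  by rewrite -(real_normK (num_real y)) lerXn2r// ?nnegrE// ltW.
have [sK|sK] := leP `|s| K.
  apply: (le_trans (dP _ sK _ yd)).
  by rewrite ler_wpDr// ler_peMr// ?lerDl ?sqr_ge0// ltW.
apply: (le_trans (h2B s y)); rewrite ler_wpDr//.
rewrite -ler_pdivrMl// mulrC -(real_normK (num_real s)).
have : `|s| <= `|s| ^+ 2 by rewrite ler_eXnr// ltW// (le_lt_trans K1).
by move: sK; rewrite /K; lra.
Unshelve. all: by end_near. Qed.

(** First-order Taylor formula whose remainder is controlled by the oscillation
of the derivative only, since the derivative need not be Lipschitz. *)
Lemma taylor1 (g h : R -> R) (s y A : R) :
  (forall x : R, is_derive x 1 g (h x)) ->
  (forall u, `|u| <= `|y| -> `|h (s + u) - h s| <= A) ->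
  `|g (s + y) - g s - y * h s| <= `|y| * A.
Proof.
move=> dg hA.
suff [u uy ->] : exists2 u, `|u| <= `|y| & g (s + y) - g s = y * h (s + u).
  by rewrite -mulrBr normrM ler_wpM2l// hA.
have cg (i : set R) : {within i, continuous g}.
  apply: continuous_subspaceT => x.
  by apply: differentiable_continuous; apply/derivable1_diffP; apply: ex_derive.
have [y0|y0] := leP 0 y.
  have [|c + ->] := @MVT_segment _ g h s (s + y) _ (fun x _ => dg x) (cg _).
    by rewrite lerDl.
  rewrite in_itv/= => /andP[sc cy]; exists (c - s); last first.
    by rewrite (_ : s + (c - s) = c); [ring|ring].
  by rewrite !ger0_norm ?subr_ge0//; lra.
have [|c + cE] := @MVT_segment _ g h (s + y) s _ (fun x _ => dg x) (cg _).
  by rewrite gerDl ltW.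
rewrite in_itv/= => /andP[sc cy]; exists (c - s); last first.
  rewrite (_ : s + (c - s) = c); last by ring.
  by rewrite -opprB cE; ring.
by rewrite ler0_norm ?subr_le0// ltr0_norm//; lra.
Qed.

End real_functions.

(** * The Stein equation *)

Section stein_equation.
Context {R : realType}.
Local Notation leb := (@lebesgue_measure R).
Local Notation phi := (@normal_pdf R 0 1).

Lemma bounded_integrable (P : probR R) (f : R -> R) (M : R) :
  measurable_fun setT f -> (forall x, `|f x| <= M) ->
  P.-integrable setT (EFin \o f).
Proof.
move=> mf fM; apply: (@le_integrable _ _ _ _ _ _ _ (EFin \o cst M)) => //.
- exact/measurable_EFinP.
- by move=> x _ /=; rewrite lee_fin (le_trans (fM x))// ler_norm.
- exact: finite_measure_integrable_cst.
Qed.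

Lemma normal_integral_centered (f : R -> R) (M : R) :
  measurable_fun setT f -> (forall x, `|f x| <= M) ->
  (\int[leb]_x ((f x - \int[normal_prob 0 1]_y f y) * phi x) = 0)%R.
Proof.
move=> mf fM; set c : R := (\int[normal_prob 0 1]_y f y)%R.
have iN := bounded_integrable _ mf fM.
have i1 : (normal_prob 0 1 : probR R).-integrable setT (EFin \o (fun x => f x - c)).
  apply: (@bounded_integrable _ _ (M + `|c|)).
    exact: measurable_funB.
  by move=> x; rewrite (le_trans (ler_normB _ _))// lerD2r.
rewrite /Rintegral.
under eq_integral do rewrite EFinM.
rewrite -(integral_normal_prob i1).
change (Rintegral (normal_prob 0 1 : probR R) setT (fun x => f x - c) = 0).
rewrite RintegralB//; [|exact: iN|exact: finite_measure_integrable_cst].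
rewrite Rintegral_cst// (_ : fine _ = 1) ?mulr1 ?subrr//.
by rewrite [X in fine X](@probability_setT _ _ _ (normal_prob 0 1 : probR R)).
Qed.

Lemma is_derive_primitiveNy (q : R -> R) (x : R) :
  continuous q -> leb.-integrable setT (EFin \o q) ->
  is_derive x 1 (fun y => \int[leb]_(t in `]-oo, y]) q t)%R (q x).
Proof.
move=> cq iq; have [||||] := @continuous_FTC1 _ q -oo%O x (x + 1).
- by rewrite ltrDl.
- exact: integrableS iq.
- by rewrite ltNyr.
- exact: cq.
- by move=> dGx Gx; apply: DeriveDef; [exact: dGx|rewrite -derive1E; exact: Gx].
Qed.

(** The solution is [g = G / phi], where [G] is the primitive of
[q = (f - c) * phi] that vanishes at [-oo].  As [q] has total integral 0, [G] is
also minus the integral of [q] over the right tail.  Mills' bound, applied to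
the left tail for negative [x] and to the right tail for positive [x], shows that
[x * g x] is bounded, hence so is [h]. *)
Lemma stein_solution (f : R -> R) (M : R) :
  continuous f -> (forall x, `|f x| <= M) ->
  exists g h : R -> R, [/\ forall x : R, is_derive x 1 g (h x), continuous h,
    exists B, forall x, `|h x| <= B &
    forall x, h x = x * g x + (f x - \int[normal_prob 0 1]_y f y)].
Proof.
move=> cf fM; have mf : measurable_fun setT f by exact: continuous_measurable_fun.
set c : R := (\int[normal_prob 0 1]_y f y)%R.
pose K := M + `|c|.
have K0 : 0 <= K by rewrite addr_ge0// (le_trans (normr_ge0 _) (fM 0)).
pose q t := (f t - c) * phi t.
have fK t : `|f t - c| <= K by rewrite (le_trans (ler_normB _ _))// lerD2r.
have qK t : `|q t| <= K * phi t.
  by rewrite normrM (ger0_norm (normal_pdf_ge0 _ _ _)) ler_wpM2r ?normal_pdf_ge0.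
have cphi := @continuous_normal_pdf01 R.
have cq : continuous q.
  move=> x; apply: cvgM; last exact: cphi.
  by apply: cvgB; [exact: cf|exact: cvg_cst].
have mq : measurable_fun setT q by exact: continuous_measurable_fun.
have mphi : measurable_fun setT phi by exact: measurable_normal_pdf.
have iphi := @integrable_normal_pdf R 0 1.
have iq : leb.-integrable setT (EFin \o q).
  apply: (le_integrable measurableT _ _ (integrableZl measurableT K iphi)) => //.
  - exact/measurable_EFinP.
  - move=> x _ /=; rewrite lee_fin (le_trans (qK x))// ger0_norm// mulr_ge0//.
    exact: normal_pdf_ge0.
have iqS (D : set R) : measurable D -> leb.-integrable D (EFin \o q).
  by move=> mD; apply: integrableS iq.
pose G x : R := (\int[leb]_(t in `]-oo, x]) q t)%R.
have dG (x : R) : is_derive x 1 G (q x).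
  exact: is_derive_primitiveNy.
have tail (D : set R) (a : R) : measurable D -> 0 <= a ->
    (a%:E * \int[leb]_(t in D) (phi t)%:E <= (phi a)%:E)%E ->
    a * `|\int[leb]_(t in D) q t| <= K * phi a.
  move=> mD a0 mills.
  rewrite -lee_fin EFinM EFin_normr_Rintegral//; last exact: iqS.
  apply: (@le_trans _ _ (a%:E * (K%:E * \int[leb]_(t in D) (phi t)%:E))%E).
    rewrite lee_wpmul2l//.
    apply: (le_trans (le_abse_integral _ _ _)) => //.
      by apply/measurable_EFinP/measurable_funTS.
    rewrite -ge0_integralZl//=; last 2 first.
      by apply/measurable_EFinP/measurable_funTS.
      by move=> x _; rewrite lee_fin normal_pdf_ge0.
    apply: ge0_le_integral => //=.
    - by apply/measurable_EFinP/measurable_funTS/measurableT_comp.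
    - by apply/measurable_EFinP/measurable_funTS/measurable_funM.
    - by move=> x _; rewrite lee_fin qK.
  by rewrite muleCA EFinM lee_wpmul2l.
have xG x : `|x * G x| <= K * phi x.
  have [x0|x0] := leP 0 x; last first.
    rewrite normrM ltr0_norm// -normal_pdf01N; apply: tail => //.
      by rewrite oppr_ge0 ltW.
    by have := @mills_left R (- x); rewrite opprK oppr_ge0; apply; exact: ltW.
  have GE : G x = - (\int[leb]_(t in `]x, +oo[) q t)%R.
    have := @Rintegral_itvB R q -oo%O +oo%O x.
    rewrite set_itvNyy => /(_ iq isT isT) <-.
    by rewrite (normal_integral_centered mf fM) sub0r opprK.
  rewrite normrM ger0_norm// GE normrN Rintegral_itv_obnd_cbnd; last exact: iqS.
  by apply: tail => //; exact: mills_right.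
pose g x := G x / phi x.
pose h x := x * g x + (f x - c).
have phi0 (x : R) : phi x != 0 by rewrite gt_eqF// normal_pdf01_gt0.
have dg (x : R) : is_derive x 1 g (h x).
  have ? := @is_derive_normal_pdf01 R x.
  have ? := dG x.
  have ? := @is_deriveV R phi x 1 (- x * phi x) (phi0 x) _.
  apply: is_derive_eq; rewrite /GRing.scale/= /h /g /q.
  by field; exact: phi0.
exists g, h; split => //.
- move=> x; apply: cvgD; last by apply: cvgB; [exact: cf|exact: cvg_cst].
  apply: cvgM; first exact: cvg_id.
  by apply: differentiable_continuous; apply/derivable1_diffP; apply: ex_derive.
- exists (K + K) => x; rewrite (le_trans (ler_normD _ _))// lerD//.
  rewrite mulrA normrM normfV (ger0_norm (normal_pdf_ge0 _ _ _)).
  by rewrite ler_pdivrMr// normal_pdf01_gt0.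
Qed.

End stein_equation.

(** * Integration against product measures *)

Section product_integrals.
Context d1 d2 (T1 : measurableType d1) (T2 : measurableType d2) (R : realType).
Variables (P : probability T1 R) (Q : probability T2 R).

Lemma prod_integrable (f : T1 -> R) (g : T2 -> R) :
  P.-integrable setT (EFin \o f) -> Q.-integrable setT (EFin \o g) ->
  (P \x Q)%E.-integrable setT (fun z => (f z.1 * g z.2)%:E).
Proof.
move=> iF ig.
have mf : measurable_fun setT f by exact/measurable_EFinP/(measurable_int _ iF).
have mg : measurable_fun setT g by exact/measurable_EFinP/(measurable_int _ ig).
have mfg : measurable_fun setT (fun z : T1 * T2 => (f z.1 * g z.2)%:E).
  by apply/measurable_EFinP/measurable_funM; exact: measurableT_comp.
apply/(integrable12ltyP _ _ mfg) => /=.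
have igabs := integrable_abse ig.
have ifabs := integrable_abse iF.
have fin := integrable_fin_num measurableT igabs.
under eq_integral.
  move=> x _.
  under eq_integral do rewrite normrM EFinM.
  rewrite integralZl//.
  over.
rewrite -(fineK fin) ge0_integralZr//=.
- rewrite fineK//; apply: lte_mul_pinfty; rewrite ?integral_ge0//.
  + exact: (integrable_fin_num measurableT ifabs).
  + by rewrite ltey_eq fin.
- by apply/measurable_EFinP/measurableT_comp.
- by rewrite lee_fin fine_ge0// integral_ge0.
Qed.

Lemma Rintegral_prodM (f : T1 -> R) (g : T2 -> R) :
  P.-integrable setT (EFin \o f) -> Q.-integrable setT (EFin \o g) ->
  (\int[(P \x Q)%E]_z (f z.1 * g z.2) = (\int[P]_x f x) * \int[Q]_y g y)%R.
Proof.
move=> iF ig; rewrite /Rintegral -(integral12_prod_meas1 (prod_integrable iF ig)).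
rewrite /fubini_F/=.
under eq_integral do (under eq_integral do rewrite EFinM); rewrite /=.
under eq_integral do rewrite integralZl//.
have fin := integrable_fin_num measurableT ig.
by rewrite -(fineK fin) integralZr//= fineM//; exact: integrable_fin_num.
Qed.

(** The slice integrals are only bounded by [b], not assumed integrable: their
measurability comes from Fubini's theorem. *)
Lemma prod_integral_bound2 (H : T1 * T2 -> R) (b : T2 -> R) :
  (P \x Q)%E.-integrable setT (EFin \o H) ->
  (forall y, P.-integrable setT (fun x => (H (x, y))%:E)) ->
  Q.-integrable setT (EFin \o b) ->
  (forall y, `|\int[P]_x H (x, y)| <= b y) ->
  `|\int[(P \x Q)%E]_z H z| <= \int[Q]_y b y.
Proof.
move=> iH iHy ib Hb.
have E y : (\int[P]_x (H (x, y))%:E = (\int[P]_x H (x, y))%R%:E)%E.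
  by rewrite /Rintegral fineK//; exact: integrable_fin_num.
have mG := measurable_fubini_G iH.
rewrite -lee_fin EFin_normr_Rintegral// -(integral21_prod_meas1 iH).
apply: (le_trans (le_abse_integral _ _ mG)) => //.
rewrite /Rintegral fineK; last exact: integrable_fin_num.
apply: ge0_le_integral => //=.
- exact: measurableT_comp.
- exact: measurable_int ib.
- by move=> y _; rewrite /fubini_G/= E lee_fin Hb.
Qed.

Lemma prod_integral_bound1 (H : T1 * T2 -> R) (b : T1 -> R) :
  (P \x Q)%E.-integrable setT (EFin \o H) ->
  (forall x, Q.-integrable setT (fun y => (H (x, y))%:E)) ->
  P.-integrable setT (EFin \o b) ->
  (forall x, `|\int[Q]_y H (x, y)| <= b x) ->
  `|\int[(P \x Q)%E]_z H z| <= \int[P]_x b x.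
Proof.
move=> iH iHx ib Hb.
have E x : (\int[Q]_y (H (x, y))%:E = (\int[Q]_y H (x, y))%R%:E)%E.
  by rewrite /Rintegral fineK//; exact: integrable_fin_num.
have mF := measurable_fubini_F iH.
rewrite -lee_fin EFin_normr_Rintegral// -(integral12_prod_meas1 iH).
apply: (le_trans (le_abse_integral _ _ mF)) => //.
rewrite /Rintegral fineK; last exact: integrable_fin_num.
apply: ge0_le_integral => //=.
- exact: measurableT_comp.
- exact: measurable_int ib.
- by move=> x _; rewrite /fubini_F/= E lee_fin Hb.
Qed.

End product_integrals.

(** * Laws with a fourth moment and their convolutions *)

Section fourth_moment.
Context {R : realType}.
Implicit Types P Q : probR R.

Definition fourth_integrable P :=
  P.-integrable setT (fun x => (x ^+ 4)%:E).

Definition moment P (k : nat) : R := \int[P]_x (x ^+ k).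

Lemma measurable_exprn (k : nat) : measurable_fun setT (fun x : R => x ^+ k).
Proof. by apply: continuous_measurable_fun; exact: exprn_continuous. Qed.

Lemma expr4_ge0 (x : R) : 0 <= x ^+ 4. Proof. exact: exprn_even_ge0. Qed.

Lemma normX_le4 (x : R) (k : nat) : (k <= 4)%N -> `|x| ^+ k <= 1 + x ^+ 4.
Proof.
move=> k4; rewrite -(ger0_norm (expr4_ge0 x)) normrX.
have [x1|x1] := leP `|x| 1.
  by rewrite (@le_trans _ _ 1) ?exprn_ile1// lerDl exprn_ge0.
by rewrite (@le_trans _ _ (`|x| ^+ 4)) ?lerDr// ler_weXn2l// ltW.
Qed.

Lemma normr_le4 (x : R) : `|x| <= 1 + x ^+ 4.
Proof. by rewrite -[leLHS]expr1; exact: normX_le4. Qed.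

Lemma sqr_le4 (x : R) : x ^+ 2 <= 1 + x ^+ 4.
Proof. by rewrite -(ger0_norm (sqr_ge0 x)) normrX normX_le4. Qed.

Lemma normrM_le4 (x y : R) : `|x| * `|y| <= 1 + x ^+ 4 + y ^+ 4.
Proof.
have := sqr_le4 x; have := sqr_le4 y; have := sqr_ge0 (`|x| - `|y|).
have := expr4_ge0 x; have := expr4_ge0 y.
by rewrite sqrrB !real_normK ?num_real// -mulr_natl; lra.
Qed.

(** The growth bound through which the lower moments and the integrand of the
Stein defect are shown to be integrable. *)
Lemma fourth_integrable_dom P (f : R -> R) (C : R) :
  fourth_integrable P -> measurable_fun setT f ->
  (forall x, `|f x| <= C * (1 + x ^+ 4)) -> P.-integrable setT (EFin \o f).
Proof.
move=> P4 mf fC.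
have i4 : P.-integrable setT (fun x => (1 + (x ^+ 4)%:E)%E).
  by apply: integrableD => //; exact: finite_measure_integrable_cst.
apply: (le_integrable measurableT _ _ (integrableZl measurableT C i4)) => //.
- exact/measurable_EFinP.
- by move=> x _ /=; rewrite lee_fin (le_trans (fC x))// ler_norm.
Qed.

Lemma fourth_integrableX P k : (k <= 4)%N ->
  fourth_integrable P -> P.-integrable setT (EFin \o (fun x => x ^+ k)).
Proof.
move=> k4 P4; apply: (@fourth_integrable_dom _ _ 1) => //.
by move=> x; rewrite mul1r normrX normX_le4.
Qed.

Lemma prod_integrable_dom P Q (H : measurableTypeR R * measurableTypeR R -> R) C :
  fourth_integrable P -> fourth_integrable Q -> measurable_fun setT H ->
  (forall x y, `|H (x, y)| <= C * (1 + x ^+ 4 + y ^+ 4)) ->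
  (P \x Q)%E.-integrable setT (EFin \o H).
Proof.
move=> P4 Q4 mH HC.
have i1 : (P \x Q)%E.-integrable setT (fun z => ((1 + z.1 ^+ 4) * 1)%:E).
  apply: (@prod_integrable _ _ _ _ _ P Q (fun x => 1 + x ^+ 4) (cst 1)).
    apply: (@fourth_integrable_dom _ _ 1) => //.
      by apply: measurable_funD => //; exact: measurable_exprn.
    by move=> x; rewrite mul1r ger0_norm// addr_ge0// expr4_ge0.
  exact: finite_measure_integrable_cst.
have i2 : (P \x Q)%E.-integrable setT (fun z => (1 * z.2 ^+ 4)%:E).
  apply: (@prod_integrable _ _ _ _ _ P Q (cst 1) (fun x => x ^+ 4)) => //.
  exact: finite_measure_integrable_cst.
have i3 := integrableZl measurableT C (integrableD measurableT i1 i2).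
apply: (le_integrable measurableT _ _ i3) => //.
- exact/measurable_EFinP.
- move=> [x y] _ /=; rewrite lee_fin (le_trans (HC x y))// mulr1 mul1r.
  exact: ler_norm.
Qed.

Lemma convolution_integrable P Q (h : R -> R) : measurable_fun setT h ->
  (P \x Q)%E.-integrable setT (fun z => (h (z.1 + z.2))%:E) ->
  (convolution P Q).-integrable setT (EFin \o h).
Proof.
move=> mh /integrableP[_ hoo]; apply/integrableP; split.
  exact/measurable_EFinP.
rewrite ge0_integral_distribution//.
by apply: measurableT_comp => //; exact/measurable_EFinP.
Qed.

Lemma integrable_convolution P Q (h : R -> R) : measurable_fun setT h ->
  (convolution P Q).-integrable setT (EFin \o h) ->
  (P \x Q)%E.-integrable setT (fun z => (h (z.1 + z.2))%:E).
Proof.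
move=> mh /integrableP[_ hoo]; apply/integrableP; split.
  apply/measurable_EFinP; apply: (measurableT_comp mh).
  exact: measurable_add_pair.
move: hoo; rewrite ge0_integral_distribution//.
by apply: measurableT_comp => //; exact/measurable_EFinP.
Qed.

Lemma Rintegral_convolution P Q (h : R -> R) : measurable_fun setT h ->
  (P \x Q)%E.-integrable setT (fun z => (h (z.1 + z.2))%:E) ->
  \int[convolution P Q]_x h x = \int[(P \x Q)%E]_z h (z.1 + z.2).
Proof.
move=> mh ih; rewrite /Rintegral integral_distribution//.
exact/measurable_EFinP.
Qed.

Lemma expr4D_le (x y : R) : (x + y) ^+ 4 <= 8 * (x ^+ 4 + y ^+ 4).
Proof.
rewrite -subr_ge0 (_ : _ - _ = (x - y) ^+ 2 * (7 * x ^+ 2 + 10 * x * y + 7 * y ^+ 2)).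
  rewrite mulr_ge0 ?sqr_ge0//.
  rewrite (_ : _ + _ = 5 * (x + y) ^+ 2 + 2 * x ^+ 2 + 2 * y ^+ 2); last by ring.
  by rewrite !addr_ge0// mulr_ge0// sqr_ge0.
by ring.
Qed.

Lemma fourth_integrable_convolution P Q :
  fourth_integrable P -> fourth_integrable Q ->
  fourth_integrable (convolution P Q).
Proof.
move=> P4 Q4; apply: convolution_integrable; first exact: measurable_exprn.
apply: (@prod_integrable_dom _ _ (fun z => (z.1 + z.2) ^+ 4) 8) => //.
  apply: measurable_funX; exact: measurable_add_pair.
move=> x y /=; rewrite ger0_norm ?expr4_ge0// (le_trans (expr4D_le _ _))//.
by rewrite ler_wpM2l// -addrA lerDr.
Qed.

(** If the fourth power of [s + Y] is integrable for one constant [s], then so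
is that of [Y]; Fubini's theorem provides such an [s].  This transfers the fourth
moment from an infinitely divisible law to its convolution roots. *)
Lemma convolution_fourth_integrable P Q :
  fourth_integrable (convolution P Q) -> fourth_integrable Q.
Proof.
move=> PQ4; have := integrable_convolution (@measurable_exprn 4) PQ4.
move=> /ae_integrable1 aeP.
have P0 : (0 < P setT)%E by rewrite probability_setT.
have [s iQ] := @filter_ex _ _ (ae_properfilter_algebraOfSetsType P0) _ aeP.
have is4 : Q.-integrable setT (fun y => (((s + y) ^+ 4)%:E + (s ^+ 4)%:E)%E).
  by apply: integrableD => //; exact: finite_measure_integrable_cst.
apply: (le_integrable measurableT _ _ (integrableZl measurableT 8 is4)) => //.
- by apply/measurable_EFinP; exact: measurable_exprn.
- move=> y _ /=; rewrite lee_fin ger0_norm ?expr4_ge0//.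
  rewrite ger0_norm ?mulr_ge0 ?addr_ge0 ?expr4_ge0//.
  have := expr4D_le (s + y) (- s).
  by rewrite (exprNn s) -signr_odd/= expr0 mul1r addrAC subrr add0r.
Qed.

End fourth_moment.

(** * Moments of convolution powers *)

Lemma Rintegral_sum d (T : measurableType d) (R : realType)
    (mu : {measure set T -> \bar R}) (D : set T) (I : Type) (s : seq I)
    (f : I -> T -> R) : measurable D ->
  (forall i, mu.-integrable D (EFin \o f i)) ->
  (\int[mu]_(x in D) \sum_(i <- s) f i x = \sum_(i <- s) \int[mu]_(x in D) f i x)%R.
Proof.
move=> mD iF; elim: s => [|i s ih].
  under eq_Rintegral do rewrite big_nil.
  by rewrite big_nil Rintegral_cst// mul0r.
under eq_Rintegral do rewrite big_cons.
rewrite big_cons -ih RintegralD//.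
have := integrable_sum mD s (fun i (_ : xpredT i) => iF i).
by apply: eq_integrable => // x _; rewrite /= sumEFin.
Qed.

Lemma Rintegral_probability_cst d (T : measurableType d) (R : realType)
  (P : probability T R) (r : R) : (\int[P]_x r = r)%R.
Proof.
by rewrite Rintegral_cst// [X in fine X](@probability_setT _ _ _ P) mulr1.
Qed.

Section moments.
Context {R : realType}.
Implicit Types P Q mu nu : probR R.

Lemma moment0 P : moment P 0 = 1.
Proof.
rewrite /moment; under eq_Rintegral do rewrite expr0.
exact: Rintegral_probability_cst.
Qed.

Lemma moment_eq mu nu k :
  (forall A, measurable A -> mu A = nu A) -> moment mu k = moment nu k.
Proof.
by move=> E; congr fine; apply: eq_measure_integral => A mA _; exact: E.
Qed.

Lemma fourth_integrable_eq mu nu :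
  (forall A, measurable A -> mu A = nu A) ->
  fourth_integrable mu -> fourth_integrable nu.
Proof.
move=> E /integrableP[m oo]; apply/integrableP; split => //.
by rewrite (eq_measure_integral mu)// => A mA _; exact/esym/E.
Qed.

Lemma moment_dirac0 k : moment (dirac (0 : measurableTypeR R)) k = (k == 0)%:R.
Proof.
rewrite /moment /Rintegral integral_dirac//=; last first.
  by apply/measurable_EFinP; exact: measurable_exprn.
by rewrite indicT mul1r expr0n.
Qed.

(** Binomial expansion, factored by independence. *)
Lemma moment_convolution P Q k : (k <= 4)%N ->
  fourth_integrable P -> fourth_integrable Q ->
  moment (convolution P Q) k =
  \sum_(i < k.+1) (moment P (k - i) * moment Q i) *+ 'C(k, i).
Proof.
move=> k4 P4 Q4.
have ile (i : 'I_k.+1) : (i <= 4)%N by rewrite (leq_trans _ k4)// -ltnS.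
have kile (i : 'I_k.+1) : (k - i <= 4)%N by rewrite (leq_trans (leq_subr _ _)).
have iM (i : 'I_k.+1) := prod_integrable
  (fourth_integrableX (kile i) P4) (fourth_integrableX (ile i) Q4).
have iPQ (i : 'I_k.+1) : (P \x Q)%E.-integrable setT
    (EFin \o fun z => 'C(k, i)%:R * (z.1 ^+ (k - i) * z.2 ^+ i)).
  exact: (integrableZl measurableT _ (iM i)).
have sumE z : (z.1 + z.2) ^+ k =
    \sum_(i < k.+1) 'C(k, i)%:R * (z.1 ^+ (k - i) * z.2 ^+ i) :> R.
  by rewrite exprDn; apply: eq_bigr => i _; rewrite mulr_natl.
rewrite /moment Rintegral_convolution.
- under eq_Rintegral do rewrite sumE.
  rewrite Rintegral_sum//; apply: eq_bigr => i _.
  rewrite RintegralZl//; last exact: iM.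
  rewrite (Rintegral_prodM (fourth_integrableX (kile i) P4)
    (fourth_integrableX (ile i) Q4)).
  by rewrite mulr_natl.
- exact: measurable_exprn.
- have := integrable_sum measurableT (index_enum 'I_k.+1) (fun i (_ : xpredT i) => iPQ i).
  by apply: eq_integrable => // z _; rewrite /= sumEFin -sumE.
Qed.

Lemma moment1_convolution P Q : fourth_integrable P -> fourth_integrable Q ->
  moment (convolution P Q) 1 = moment P 1 + moment Q 1.
Proof.
move=> P4 Q4; rewrite moment_convolution// !big_ord_recl big_ord0/= /bump/=.
by rewrite !subnn !subn0 !moment0 /binomial/=; ring.
Qed.

Lemma moment2_convolution P Q : fourth_integrable P -> fourth_integrable Q ->
  moment P 1 = 0 -> moment Q 1 = 0 ->
  moment (convolution P Q) 2 = moment P 2 + moment Q 2.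
Proof.
move=> P4 Q4 P1 Q1.
rewrite moment_convolution// !big_ord_recl big_ord0/= /bump/= !addn0 ?add1n.
by rewrite ?subnn ?subn0 ?moment0 /= P1 Q1 /binomial/=; ring.
Qed.

Lemma moment4_convolution P Q : fourth_integrable P -> fourth_integrable Q ->
  moment P 1 = 0 -> moment Q 1 = 0 ->
  moment (convolution P Q) 4 =
  moment P 4 + 6 * (moment P 2 * moment Q 2) + moment Q 4.
Proof.
move=> P4 Q4 P1 Q1.
rewrite moment_convolution// !big_ord_recl big_ord0/= /bump/= ?add1n.
by rewrite ?subnn ?subn0 ?subSS ?subn0 ?moment0 /= P1 Q1 /binomial/=; ring.
Qed.

Lemma fourth_integrable_dirac0 :
  fourth_integrable (R := R) (dirac (0 : measurableTypeR R)).
Proof.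
apply/integrableP; split; first by apply/measurable_EFinP; exact: measurable_exprn.
rewrite integral_dirac//; first by rewrite diracT mul1e ltry.
by apply/measurable_EFinP/measurableT_comp => //; exact: measurable_exprn.
Qed.

Lemma fourth_integrable_power nu N :
  fourth_integrable nu -> fourth_integrable (convolution_power nu N).
Proof.
move=> nu4; elim: N => [|N IH] /=; first exact: fourth_integrable_dirac0.
exact: fourth_integrable_convolution.
Qed.

Lemma moment1_power nu N : fourth_integrable nu ->
  moment (convolution_power nu N) 1 = N%:R * moment nu 1.
Proof.
move=> nu4; elim: N => [|N IH] /=; first by rewrite moment_dirac0 mul0r.
rewrite moment1_convolution// ?IH; last exact: fourth_integrable_power.
by rewrite -[in RHS]natr1; ring.
Qed.

Lemma moment2_power nu N : fourth_integrable nu -> moment nu 1 = 0 ->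
  moment (convolution_power nu N) 2 = N%:R * moment nu 2.
Proof.
move=> nu4 nu1; elim: N => [|N IH] /=; first by rewrite moment_dirac0 mul0r.
rewrite moment2_convolution// ?IH ?moment1_power// ?nu1 ?mulr0//.
  by rewrite -[in RHS]natr1; ring.
exact: fourth_integrable_power.
Qed.

Lemma moment4_power nu N : fourth_integrable nu -> moment nu 1 = 0 ->
  moment (convolution_power nu N) 4 =
  N%:R * moment nu 4 + 3 * (N%:R * (N%:R - 1)) * moment nu 2 ^+ 2.
Proof.
move=> nu4 nu1; elim: N => [|N IH] /=.
  by rewrite moment_dirac0 !(mul0r, mulr0) addr0.
rewrite moment4_convolution// ?IH ?moment2_power ?moment1_power// ?nu1 ?mulr0//.
  by rewrite -[in RHS]natr1; ring.
exact: fourth_integrable_power.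
Qed.

End moments.

(** * The defect in Stein's identity is additive under convolution *)

Section stein_defect.
Context {R : realType}.
Implicit Types P Q nu : probR R.
Variables (g h : R -> R) (C : R).
Hypotheses (mg : measurable_fun setT g) (mh : measurable_fun setT h).
Hypotheses (gC : forall x, `|g x| <= C * (1 + `|x|)) (hC : forall x, `|h x| <= C).

(** The argument [z] translates the test function: [h] stands for the derivative
of [g] and [v] for the variance. *)
Definition stein_integrand (v z x : R) := x * g (z + x) - v * h (z + x).

Definition stein_defect P (z : R) : R :=
  \int[P]_x stein_integrand (moment P 2) z x.

Let C0 : 0 <= C. Proof. exact: le_trans (normr_ge0 _) (hC 0). Qed.

Lemma stein_integrand_le (v z x y : R) :
  `|stein_integrand v (z + y) x| <=
  C * (3 + `|z| + `|v|) * (1 + x ^+ 4 + y ^+ 4).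
Proof.
apply: (@le_trans _ _ (C * (`|x| * (1 + `|z| + `|x| + `|y|) + `|v|))).
  rewrite (le_trans (ler_normB _ _))// !normrM mulrDr lerD//; last first.
    by rewrite mulrC ler_wpM2r.
  rewrite mulrCA ler_wpM2l// (le_trans (gC _))// ler_wpM2l//.
  have := ler_normD (z + y) x; have := ler_normD z y; lra.
rewrite -mulrA ler_wpM2l//.
have x1 := normr_le4 x; have x2 := sqr_le4 x; have x4 := expr4_ge0 x.
have xy := normrM_le4 x y; have y4 := expr4_ge0 y.
have v1 : `|v| <= `|v| * (1 + x ^+ 4 + y ^+ 4).
  by rewrite ler_peMr// -addrA lerDl addr_ge0.
have z1 : `|z| * `|x| <= `|z| * (1 + x ^+ 4 + y ^+ 4).
  by rewrite ler_wpM2l// (le_trans x1)// lerDl.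
rewrite !mulrDr mulr1 -expr2 real_normK ?num_real//.
by rewrite !mulrDl; lra.
Qed.

Lemma measurable_stein_integrand d (T : measurableType d) v z (a b : T -> R) :
  measurable_fun setT a -> measurable_fun setT b ->
  measurable_fun setT (fun u => stein_integrand v (z + b u) (a u)).
Proof.
move=> ma mb; have mzba : measurable_fun setT (fun u => z + b u + a u).
  by apply: measurable_funD => //; exact: measurable_funD.
apply: measurable_funB; apply: measurable_funM => //.
- exact: (measurableT_comp mg mzba).
- exact: (measurableT_comp mh mzba).
Qed.

Lemma measurable_stein_integrandT v z : measurable_fun setT (stein_integrand v z).
Proof.
have mz : measurable_fun setT (fun x : R => z + x) by exact: measurable_funD.
apply: measurable_funB; apply: measurable_funM => //; exact: measurableT_comp.
Qed.

Lemma stein_integrand_integrable P v z : fourth_integrable P ->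
  P.-integrable setT (EFin \o stein_integrand v z).
Proof.
move=> P4; apply: (@fourth_integrable_dom _ _ _ (C * (3 + `|z| + `|v|))) => //.
  exact: measurable_stein_integrandT.
by move=> x; have := stein_integrand_le v z x 0; rewrite expr0n !addr0.
Qed.

Lemma stein_prod_integrable1 P Q v z :
  fourth_integrable P -> fourth_integrable Q ->
  (P \x Q)%E.-integrable setT (EFin \o
    fun u : measurableTypeR R * measurableTypeR R => stein_integrand v (z + u.2) u.1).
Proof.
move=> P4 Q4; apply: (@prod_integrable_dom _ _ _ _ (C * (3 + `|z| + `|v|))) => //.
  exact: measurable_stein_integrand.
by move=> x y /=; exact: stein_integrand_le.
Qed.

Lemma stein_prod_integrable2 P Q v z :
  fourth_integrable P -> fourth_integrable Q ->
  (P \x Q)%E.-integrable setT (EFin \o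
    fun u : measurableTypeR R * measurableTypeR R => stein_integrand v (z + u.1) u.2).
Proof.
move=> P4 Q4; apply: (@prod_integrable_dom _ _ _ _ (C * (3 + `|z| + `|v|))) => //.
  exact: measurable_stein_integrand.
by move=> x y /=; rewrite [1 + _ + _]addrAC; exact: stein_integrand_le.
Qed.

Lemma quad_integrable P (A B z : R) : fourth_integrable P ->
  P.-integrable setT (EFin \o fun x : R => A + B * (z + x) ^+ 2).
Proof.
move=> P4.
have i1 := fourth_integrableX (isT : (1 <= 4)%N) P4.
have i2 := fourth_integrableX (isT : (2 <= 4)%N) P4.
have ic := finite_measure_integrable_cst P (A + B * z ^+ 2) measurableT.
have := integrableD measurableT ic (integrableD measurableT
  (integrableZl measurableT (2 * B * z) i1) (integrableZl measurableT B i2)).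
apply: eq_integrable => // x _; rewrite /= -!EFinD; congr EFin.
by rewrite expr1; ring.
Qed.

(** The cross term vanishes for a centred law. *)
Lemma Rintegral_quad P (A B z : R) : fourth_integrable P -> moment P 1 = 0 ->
  \int[P]_x (A + B * (z + x) ^+ 2) = A + B * z ^+ 2 + B * moment P 2.
Proof.
move=> P4 P1.
have i1 := fourth_integrableX (isT : (1 <= 4)%N) P4.
have i2 := fourth_integrableX (isT : (2 <= 4)%N) P4.
have ic := finite_measure_integrable_cst P (A + B * z ^+ 2) measurableT.
transitivity (\int[P]_x ((A + B * z ^+ 2) + ((2 * B * z) * x ^+ 1 + B * x ^+ 2))).
  by apply: eq_Rintegral => x _; rewrite expr1; ring.
have j1 : P.-integrable setT (EFin \o fun x : R => 2 * B * z * x ^+ 1).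
  exact: (integrableZl measurableT _ i1).
have j2 : P.-integrable setT (EFin \o fun x : R => B * x ^+ 2).
  exact: (integrableZl measurableT _ i2).
have j12 : P.-integrable setT (EFin \o fun x : R => 2 * B * z * x ^+ 1 + B * x ^+ 2).
  exact: (integrableD measurableT j1 j2).
rewrite (RintegralD measurableT ic j12) (RintegralD measurableT j1 j2) /=.
rewrite !RintegralZl// Rintegral_probability_cst.
by rewrite -![\int[P]_x x ^+ _]/(moment P _) P1 mulr0 add0r.
Qed.

(** The integrand of [P * Q] at [x + y] is the sum of the integrand of [P]
translated by [z + y] and that of [Q] translated by [z + x].  Integrating the
former first in [x] gives the defect of [P] at [z + y]; its bound
[A + B * (z + y) ^+ 2] then integrates over [y] to
[A + B * z ^+ 2 + B * moment Q 2]. *)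
Lemma stein_defect_convolution P Q (A A' B B' : R) :
  fourth_integrable P -> fourth_integrable Q ->
  moment P 1 = 0 -> moment Q 1 = 0 ->
  (forall z, `|stein_defect P z| <= A + B * z ^+ 2) ->
  (forall z, `|stein_defect Q z| <= A' + B' * z ^+ 2) ->
  forall z, `|stein_defect (convolution P Q) z| <=
    (A + A' + B * moment Q 2 + B' * moment P 2) + (B + B') * z ^+ 2.
Proof.
move=> P4 Q4 P1 Q1 dP dQ z.
rewrite /stein_defect moment2_convolution//.
set p := moment P 2; set q := moment Q 2.
have i1 := stein_prod_integrable1 p z P4 Q4.
have i2 := stein_prod_integrable2 q z P4 Q4.
have E (x y : R) : stein_integrand (p + q) z (x + y) =
    stein_integrand p (z + y) x + stein_integrand q (z + x) y.
  rewrite /stein_integrand.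
  by rewrite (_ : z + y + x = z + (x + y)) 1?(_ : z + x + y = z + (x + y)); ring.
have iE : (P \x Q)%E.-integrable setT
    (fun u => (stein_integrand (p + q) z (u.1 + u.2))%:E).
  have := integrableD measurableT i1 i2.
  by apply: eq_integrable => // u _; rewrite /= -EFinD E.
rewrite Rintegral_convolution//; last exact: measurable_stein_integrandT.
under eq_Rintegral do rewrite E.
rewrite RintegralD//.
have b1 : `|\int[(P \x Q)%E]_u stein_integrand p (z + u.2) u.1| <=
    A + B * z ^+ 2 + B * q.
  rewrite -Rintegral_quad//; apply: (prod_integral_bound2 i1) => [y||y] /=.
  - exact: stein_integrand_integrable.
  - exact: quad_integrable.
  - exact: dP.
have b2 : `|\int[(P \x Q)%E]_u stein_integrand q (z + u.1) u.2| <=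
    A' + B' * z ^+ 2 + B' * p.
  rewrite -Rintegral_quad//; apply: (prod_integral_bound1 i2) => [y||y] /=.
  - exact: stein_integrand_integrable.
  - exact: quad_integrable.
  - exact: dQ.
by rewrite (le_trans (ler_normD _ _))// (le_trans (lerD b1 b2))//; lra.
Qed.

(** The additive constants obey [A_(N+1) = A_N + A + 2 * N * B * moment nu 2],
whose solution has the displayed term [N * (N - 1)]. *)
Lemma stein_defect_power nu (A B : R) N :
  fourth_integrable nu -> moment nu 1 = 0 ->
  (forall z, `|stein_defect nu z| <= A + B * z ^+ 2) ->
  forall z, `|stein_defect (convolution_power nu N) z| <=
    (N%:R * A + N%:R * (N%:R - 1) * B * moment nu 2) + N%:R * B * z ^+ 2.
Proof.
move=> nu4 nu1 dnu; elim: N => [|N IH] z.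
  rewrite /= /stein_defect moment_dirac0 /= !mul0r !addr0.
  rewrite /Rintegral integral_dirac//=.
    by rewrite /stein_integrand indicT !mul0r subr0 mul1r normr0.
  by apply/measurable_EFinP; exact: measurable_stein_integrandT.
have pow4 := fourth_integrable_power N nu4.
have pow1 : moment (convolution_power nu N) 1 = 0.
  by rewrite moment1_power// nu1 mulr0.
have := stein_defect_convolution pow4 nu4 pow1 nu1 IH dnu z.
rewrite moment2_power// => /le_trans; apply; rewrite -natr1 le_eqVlt.
by apply/orP; left; apply/eqP; ring.
Qed.

End stein_defect.

(** * The defect of an infinitely divisible law *)

Section stein_defect_infinitely_divisible.
Context {R : realType}.
Implicit Types nu mu : probR R.
Variables (g h : R -> R) (M : R).
Hypotheses (dg : forall x : R, is_derive x 1 g (h x)) (ch : continuous h).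
Hypothesis (hM : forall x, `|h x| <= M).

Let C : R := `|g 0| + 3 * M.

Let M0 : 0 <= M. Proof. exact: le_trans (normr_ge0 _) (hM 0). Qed.

Lemma derive_bounded_growth x : `|g x| <= C * (1 + `|x|).
Proof.
have h0 u : `|h (0 + u) - h 0| <= 2 * M.
  rewrite (le_trans (ler_normB _ _))//.
  by have := hM (0 + u); have := hM 0; lra.
have := @taylor1 _ g h 0 x (2 * M) dg (fun u _ => h0 u).
rewrite add0r => t.
have E : g x = (g x - g 0 - x * h 0) + (g 0 + x * h 0) by ring.
have t2 : `|g x| <= `|x| * (2 * M) + (`|g 0| + `|x| * M).
  rewrite E (le_trans (ler_normD _ _))// lerD// (le_trans (ler_normD _ _))//.
  by rewrite lerD// normrM ler_wpM2l.
rewrite (le_trans t2)// /C.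
by have := M0; have : 0 <= `|g 0| * `|x| by []; lra.
Qed.

Let hC x : `|h x| <= C.
Proof. by rewrite (le_trans (hM x))// /C; have := M0; have := normr_ge0 (g 0); lra. Qed.

Let mh : measurable_fun setT h.
Proof. exact: continuous_measurable_fun. Qed.

Let mg : measurable_fun setT g.
Proof.
apply: continuous_measurable_fun => x.
by apply: differentiable_continuous; apply/derivable1_diffP; apply: ex_derive.
Qed.

Variables (e D : R).
Hypotheses (e0 : 0 <= e) (D0 : 0 <= D).
Hypothesis (hmod : forall s y, `|h (s + y) - h s| <= e * (1 + s ^+ 2) + D * y ^+ 2).

(** The integrand differs from [r], which involves only increments of [g] and
[h], by a linear combination [l] of [1], [x] and [x ^+ 2] whose integral vanishes
because [nu] is centred with variance [moment nu 2]. *)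
Lemma stein_defect_single nu z : fourth_integrable nu -> moment nu 1 = 0 ->
  `|stein_defect g h nu z| <=
    (2 * moment nu 2 * e + D * (moment nu 4 + moment nu 2 ^+ 2))
    + 2 * moment nu 2 * e * z ^+ 2.
Proof.
move=> nu4 nu1; set v := moment nu 2.
have v0 : 0 <= v by apply: Rintegral_ge0 => x _; exact: sqr_ge0.
have iX k (k4 : (k <= 4)%N) c : nu.-integrable setT (EFin \o fun x : R => c * x ^+ k).
  exact: (integrableZl measurableT c (fourth_integrableX k4 nu4)).
have RX k (k4 : (k <= 4)%N) c : \int[nu]_x (c * x ^+ k) = c * moment nu k.
  by rewrite RintegralZl//; exact: fourth_integrableX.
pose r x := x * (g (z + x) - g z - x * h z) - v * (h (z + x) - h z).
pose l x := g z * x ^+ 1 + (h z * x ^+ 2 + - (v * h z) * x ^+ 0).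
have i1 := iX 1%N isT (g z).
have i2 : nu.-integrable setT
    (EFin \o fun x : R => h z * x ^+ 2 + - (v * h z) * x ^+ 0).
  exact: (integrableD measurableT (iX 2%N isT (h z)) (iX 0%N isT (- (v * h z)))).
have il : nu.-integrable setT (EFin \o l) by exact: (integrableD measurableT i1 i2).
have l0 : \int[nu]_x l x = 0.
  rewrite (RintegralD measurableT i1 i2).
  rewrite (RintegralD measurableT (iX 2%N isT (h z)) (iX 0%N isT (- (v * h z)))).
  by rewrite !RX// nu1 moment0 -/v; ring.
have istein := stein_integrand_integrable mg mh derive_bounded_growth hC v z nu4.
have rE x : r x = stein_integrand g h v z x - l x.
  by rewrite /r /l /stein_integrand expr0 expr1; ring.
have ir : nu.-integrable setT (EFin \o r).
  have := integrableB measurableT istein il.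
  by apply: eq_integrable => // x _; rewrite /= -EFinB rE.
have -> : stein_defect g h nu z = \int[nu]_x r x.
  under [RHS]eq_Rintegral do rewrite rE.
  by rewrite (RintegralB measurableT istein il) l0 subr0.
pose E := e * (1 + z ^+ 2).
have E0 : 0 <= E by rewrite mulr_ge0// addr_ge0// sqr_ge0.
pose b x := D * x ^+ 4 + ((E + v * D) * x ^+ 2 + v * E * x ^+ 0).
have j2 : nu.-integrable setT
    (EFin \o fun x : R => (E + v * D) * x ^+ 2 + v * E * x ^+ 0).
  exact: (integrableD measurableT (iX 2%N isT _) (iX 0%N isT _)).
have ib : nu.-integrable setT (EFin \o b).
  exact: (integrableD measurableT (iX 4%N isT D) j2).
have rb x : `|r x| <= b x.
  have t : `|g (z + x) - g z - x * h z| <= `|x| * (E + D * x ^+ 2).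
    apply: (taylor1 dg) => u ux; apply: (le_trans (hmod z u)).
    rewrite lerD2l ler_wpM2l// -(real_normK (num_real u)) -(real_normK (num_real x)).
    by rewrite lerXn2r ?nnegrE.
  rewrite (le_trans (ler_normB _ _))// !normrM (ger0_norm v0).
  apply: (@le_trans _ _ (`|x| * (`|x| * (E + D * x ^+ 2)) + v * (E + D * x ^+ 2))).
    by rewrite lerD// ler_wpM2l// hmod.
  rewrite mulrA -expr2 real_normK ?num_real// le_eqVlt; apply/orP; left; apply/eqP.
  by rewrite /b expr0; ring.
apply: (le_trans (le_normr_Rintegral measurableT ir)).
apply: (@le_trans _ _ (\int[nu]_x b x)).
  by apply: le_Rintegral => //; exact: (integrable_norm ir).
rewrite (RintegralD measurableT (iX 4%N isT D) j2).
rewrite (RintegralD measurableT (iX 2%N isT _) (iX 0%N isT _)).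
rewrite !RX// moment0 -/v le_eqVlt; apply/orP; left; apply/eqP.
by rewrite /E; ring.
Qed.

(** For the [N]-fold root [nu] one has [moment nu 2 = 1 / N] and
[N * moment nu 4 = moment mu 4 - 3 + 3 / N], so the bound of
[stein_defect_power] exceeds the claim by at most [4 * D / N]. *)
Lemma stein_defect_infinitely_divisible mu :
  infinitely_divisible mu -> fourth_integrable mu ->
  moment mu 1 = 0 -> moment mu 2 = 1 ->
  `|stein_defect g h mu 0| <= 4 * e + D * (moment mu 4 - 3).
Proof.
move=> ID mu4 mu1 mu2; apply/ler_addgt0Pr => d d0.
(* The number of summands is chosen so that [4 * D / N <= d]. *)
pose n := Num.bound (4 * D / d).
have nP : 4 * D / d < n%:R.
  have := archi_boundP (_ : 0 <= 4 * D / d); rewrite divr_ge0 ?mulr_ge0// ?ltW//.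
  exact.
have [nu E] := ID n.+1 isT.
have pow4 := fourth_integrable_eq E mu4.
have nu4 : fourth_integrable nu by exact: convolution_fourth_integrable pow4.
pose N : R := n.+1%:R.
have N0 : 0 < N by rewrite ltr0n.
have Nn0 : N != 0 by rewrite gt_eqF.
have nu1 : moment nu 1 = 0.
  have := moment1_power n.+1 nu4; rewrite -(moment_eq 1 E) mu1 => /esym/eqP.
  by rewrite mulf_eq0 -/N (negbTE Nn0) => /eqP.
have nu2 : moment nu 2 = N^-1.
  have := moment2_power n.+1 nu4 nu1; rewrite -(moment_eq 2 E) mu2 -/N => H.
  by apply: (mulfI Nn0); rewrite -H divff.
have nu4E : N * moment nu 4 = moment mu 4 - 3 + 3 * N^-1.
  have := moment4_power n.+1 nu4 nu1; rewrite -(moment_eq 4 E) nu2 -/N => ->.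
  by field.
have -> : stein_defect g h mu 0 = stein_defect g h (convolution_power nu n.+1) 0.
  rewrite /stein_defect (moment_eq 2 E).
  by congr fine; apply: eq_measure_integral => A mA _; exact: E.
apply: (le_trans (stein_defect_power mg mh derive_bounded_growth hC n.+1 nu4 nu1
  (fun z => stein_defect_single z nu4 nu1) 0)).
rewrite -/N nu2 expr0n/= mulr0 addr0.
have -> : N * (2 * N^-1 * e + D * (moment nu 4 + N^-1 ^+ 2)) +
    N * (N - 1) * (2 * N^-1 * e) * N^-1 =
    4 * e + D * (N * moment nu 4 + N^-1) - 2 * e * N^-1 by field.
rewrite nu4E.
have ND : 4 * D * N^-1 <= d.
  rewrite ler_pdivrMr// [leRHS]mulrC -ler_pdivrMr// (le_trans (ltW nP))//.
  by rewrite ler_nat.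
have eN : 0 <= 2 * e * N^-1 by rewrite !mulr_ge0// invr_ge0 ltW.
rewrite (_ : _ - _ = 4 * e + D * (moment mu 4 - 3) + (4 * D * N^-1 - 2 * e * N^-1)).
  by rewrite lerD2l lerBlDr ler_wpDr.
by ring.
Qed.

End stein_defect_infinitely_divisible.

(** * Convergence to the normal law *)

Local Open Scope ereal_scope.

Theorem theorem1p3 (R : realType) (mu : nat -> probR R)
  (mean0 : forall n, (0 < n)%N -> 'E_(mu n)[fun x => x] = 0)
  (var1 : forall n, (0 < n)%N -> 'V_(mu n)[fun x => x] = 1)
  (mu_ID : forall n, (0 < n)%N -> infinitely_divisible (mu n))
  (fourth : 'E_(mu n)[fun x => (x ^+ 4)%R] @[n --> \oo] --> 3%:E) :
  cvg_weakly mu (normal_prob 0%R 1%R).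
Proof.
have m1 n : (0 < n)%N -> moment (mu n) 1 = 0%R.
  by move=> n0; have := mean0 n n0; rewrite /moment /Rintegral unlock /= => ->.
have m2 n : (0 < n)%N -> moment (mu n) 2 = 1%R.
  move=> n0; have := var1 n n0; rewrite /variance unlock (mean0 n n0)/= unlock.
  rewrite /moment /Rintegral => H; rewrite -[RHS]/(fine 1%E) -H; congr fine.
  by apply: eq_integral => x _ /=; rewrite fctE/= subr0 expr2.
have /fine_cvgP[fin4 cvg4] := fourth.
move=> f cf [M0 [_ bf]].
have {}bf x : (`|f x| <= M0 + 1)%R by apply: bf => //; rewrite ltrDl.
have mf : measurable_fun setT f by exact: continuous_measurable_fun.
have intf (P : probR R) : \int[P]_x (f x)%:E = (\int[P]_x f x)%R%:E.
  rewrite /Rintegral fineK//; apply: integrable_fin_num => //.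
  exact: bounded_integrable bf.
have [g [h [dg ch [B hB] hE]]] := stein_solution cf bf.
rewrite intf; under eq_fun do rewrite intf.
apply: cvg_EFin; first exact: nearW.
apply/cvgrPdist_le => eps eps0 /=.
(* [4 * e] takes one half of [eps]; the fourth moment takes the other. *)
pose e : R := (eps / 8)%R.
have e0 : (0 < e)%R by rewrite divr_gt0.
have [D D0 hmod] := bounded_continuous_modulus ch hB e0.
have D1 : (0 < D + 1)%R by rewrite ltr_wpDl.
move/cvgrPdist_le : cvg4 => /(_ (eps / 2 / (D + 1))%R).
rewrite !divr_gt0// => /(_ isT) cvg4.
near=> n.
have n0 : (0 < n)%N by near: n; exact: nbhs_infty_gt.
have fn : 'E_(mu n)[fun x => (x ^+ 4)%R] \is a fin_num by near: n.
have mu4 : fourth_integrable (mu n).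
  apply/integrableP; split; first by apply/measurable_EFinP; exact: measurable_exprn.
  move: fn; rewrite unlock ge0_fin_numE; last first.
    by apply: integral_ge0 => x _; rewrite lee_fin expr4_ge0.
  by apply: le_lt_trans; rewrite le_eqVlt; apply/orP; left; apply/eqP;
    apply: eq_integral => x _ /=; rewrite ger0_norm ?expr4_ge0.
have d4 : (`|3 - moment (mu n) 4| <= eps / 2 / (D + 1))%R.
  have : (`|3 - fine 'E_(mu n)[fun x => (x ^+ 4)%R]| <= eps / 2 / (D + 1))%R by near: n.
  by rewrite /moment /Rintegral unlock.
have := stein_defect_infinitely_divisible dg ch hB (ltW e0) D0 hmod (mu_ID n n0) mu4 (m1 n n0) (m2 n n0).
set c : R := (\int[normal_prob 0 1]_y f y)%R in hE *.
have -> : stein_defect g h (mu n) 0 = (c - \int[mu n]_x f x)%R.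
  rewrite /stein_defect m2//.
  transitivity (\int[mu n]_x (c - f x))%R.
    apply: eq_Rintegral => x _.
    by rewrite /stein_integrand add0r mul1r hE; ring.
  rewrite RintegralB ?Rintegral_probability_cst//.
    exact: finite_measure_integrable_cst.
  exact: bounded_integrable bf.
move=> /le_trans; apply.
have : (D * (moment (mu n) 4 - 3) <= (D + 1) * `|3 - moment (mu n) 4|)%R.
  rewrite distrC (le_trans (ler_norm _))// normrM (ger0_norm D0).
  by rewrite ler_wpM2r// lerDl.
have : ((D + 1) * `|3 - moment (mu n) 4| <= eps / 2)%R.
  by rewrite mulrC -ler_pdivlMr.
by rewrite /e; lra.
Unshelve. all: by end_near. Qed.
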